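(* Let $T\colon X\rightrightarrows X$ be a union nonexpansive operator, with a fixed representation $T(x)=\{T_i(x):i\in\varphi(x)\}$, let $x^*\in\mathbf{Fix}\,T$, and let $(\lambda_n)_{n\in\mathbb{N}}$ be a sequence in $(0,1]$ with $\liminf_{n\to\infty}\lambda_n(1-\lambda_n)>0$. Denote $r:=r(x^*;T)\in(0,+\infty]$ and consider a sequence $(x_n)_{n\in\mathbb{N}}$ with $x_0\in\operatorname{int}\mathbb{B}(x^*;r)$ satisfying $$\forall n\in\mathbb{N},\quad x_{n+1}\in(1-\lambda_n)x_n+\lambda_nT(x_n).$$ Then $(x_n)_{n\in\mathbb{N}}$ converges to a point $\overline{x}\in\operatorname{Fix}T\cap\mathbb{B}(x^*;r)$.
   Context: $X$ is a real finite-dimensional Hilbert space with norm $\|\cdot\|$. A set-valued map $\varphi\colon X\rightrightarrows I$ is outer semicontinuous (osc) if, whenever $x_n\to\bar x$ and $i_n\to i$ with $i_n\in\varphi(x_n)$, one has $i\in\varphi(\bar x)$ (finite sets carry the discrete topology). $T\colon X\rightrightarrows X$ is union nonexpansive if $T(x)=\{T_i(x):i\in\varphi(x)\}$ for all $x\in X$, where $I$ is a finite index set, each $T_i\colon X\to X$ is nonexpansive (i.e. $\|T_ix-T_iy\|\le\|x-y\|$ for all $x,y$), and $\varphi\colon X\rightrightarrows I$ is osc with nonempty values; such a representation is fixed. $\operatorname{Fix}T:=\{x:x\in T(x)\}$ and $\mathbf{Fix}\,T:=\{x:T(x)=\{x\}\}$. $\mathbb{B}(x;\delta)$ is the closed ball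 of center $x$ and radius $\delta$ (all of $X$ if $\delta=+\infty$). The radius of attraction of $T$ (with respect to the fixed representation) at $x^*$ is $r(x^*;T):=\sup\{\delta>0:\forall x\in\mathbb{B}(x^*;\delta),\ \varphi(x)\subseteq\varphi(x^* )\}$; it always lies in $(0,+\infty]$. *)

(* Defs.v *)
From HB Require Import structures.
From mathcomp Require Import all_boot all_order all_algebra.
From mathcomp Require Import all_classical all_reals all_analysis.

Set Implicit Arguments.
Unset Strict Implicit.
Unset Printing Implicit Defensive.

Import Order.TTheory GRing.Theory Num.Theory.
Import numFieldNormedType.Exports.

Local Open Scope classical_set_scope.
Local Open Scope ring_scope.

(* Completeness is not required: it follows from finite dimension. *)
HB.mixin Record NormedModule_hasInnerProduct (R : realType) X
    & NormedModule R X := {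
  inner : {dot X for idfun} ;
  sqr_norm_inner : forall x : X, `|x| ^+ 2 = inner x x }.

#[short(type="finHilbertType")]
HB.structure Definition FinHilbert (R : realType) :=
  {X of NormedModule R X & Vector R X & NormedModule_hasInnerProduct R X}.

Definition outer_semicontinuous {X Y : topologicalType} (phi : X -> set Y) : Prop :=
  forall (x_ : nat -> X) (y_ : nat -> Y) (x : X) (y : Y),
    x_ @ \oo --> x -> y_ @ \oo --> y ->
    (forall n, phi (x_ n) (y_ n)) -> phi x y.

Definition Fix {X : Type} (T : X -> set X) : set X := [set x | T x x].

Definition strongFix {X : Type} (T : X -> set X) : set X := [set x | T x = [set x]].

Section UnionNonexpansive.
Context {R : realType} {X : normedModType R} {I : finType}.

Definition nonexpansive (f : X -> X) : Prop :=
  forall x y, `|f x - f y| <= `|x - y|.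

Definition union_nonexpansive
    (T : X -> set X) (T_ : I -> X -> X) (phi : X -> set I) : Prop :=
  [/\ forall x, T x = [set T_ i x | i in phi x],
      forall i, nonexpansive (T_ i),
      outer_semicontinuous (phi : X -> set (discrete_topology I)) &
      forall x, phi x !=set0].

(* The radius is extended real: [cball x +oo] is the whole space. *)
Definition cball (x : X) (delta : \bar R) : set X :=
  [set y | (`|x - y|%:E <= delta)%E].

Definition attraction_radius (phi : X -> set I) (x : X) : \bar R :=
  ereal_sup [set delta%:E | delta in [set delta : R |
    0 < delta /\ forall y, cball x delta%:E y -> phi y `<=` phi x]].

End UnionNonexpansive.

(* Main.v *)
Require Import Defs.
From HB Require Import structures.
From mathcomp Require Import all_boot all_order all_algebra.
From mathcomp Require Import all_classical all_reals all_analysis.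
From mathcomp Require Import ring lra.

Set Implicit Arguments.
Unset Strict Implicit.
Unset Printing Implicit Defensive.

Import Order.TTheory GRing.Theory Num.Theory.
Import numFieldNormedType.Exports.

Local Open Scope classical_set_scope.
Local Open Scope ring_scope.

(** Choose for each [n] an index [k n] active at [x_ n] with
    [x_ n.+1 = (1 - lambda n) *: x_ n + lambda n *: T_ (k n) (x_ n)].

    Every index active at [xstar] gives an operator fixing [xstar], because
    [T xstar] is reduced to [xstar]. Points no further from [xstar] than [x_ 0]
    only have active indices that are also active at [xstar]
    ([attraction_ball]). Since a relaxed step with an operator fixing [xstar]
    does not increase the distance to [xstar], the whole sequence stays in that
    region: it is Fejer monotone with respect to [xstar], and bounded.

    The convexity identity [sqr_norm_convex] quantifies the decrease of the
    distance. As the weights [lambda n * (1 - lambda n)] are eventually bounded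
    below, the residuals [`|x_ n - T_ (k n) (x_ n)|] tend to 0
    ([mann_residual_cvg0]).

    By finite dimension the sequence has a cluster point [y]
    ([bounded_seq_has_cluster]). The operators change along the iteration, so
    it is not immediate that the sequence is Fejer monotone with respect to
    [y]. However, there are finitely many operators, and those that move [y]
    have large residuals near [y]; therefore, close to [y] and late in the
    iteration, only operators fixing [y] are used. Such steps do not leave the
    neighbourhood, and the sequence converges to [y] ([mann_cluster_cvg]).

    Finally, some index occurs infinitely often; it fixes [y], and is active at
    [y] by outer semicontinuity, so [y] is a fixed point of [T]. *)

(** * Inner products and compactness *)

Section InnerProduct.
Context {R : realType} {X : finHilbertType R}.
Implicit Types (x y z : X) (t : R).

Lemma innerC x y : inner x y = inner y x.
Proof. by rewrite hermC /= expr0 mul1r. Qed.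

Lemma innerDl x y z : inner (x + y) z = inner x z + inner y z.
Proof. exact: linearDl. Qed.

Lemma innerDr x y z : inner x (y + z) = inner x y + inner x z.
Proof. by rewrite innerC innerDl !(innerC x). Qed.

Lemma innerZl t x y : inner (t *: x) y = t * inner x y.
Proof. exact: linearZl_LR. Qed.

Lemma innerZr t x y : inner x (t *: y) = t * inner x y.
Proof. by rewrite innerC innerZl innerC. Qed.

Lemma sqr_normD x y : `|x + y| ^+ 2 = `|x| ^+ 2 + 2 * inner x y + `|y| ^+ 2.
Proof.
by rewrite !sqr_norm_inner innerDl !innerDr (innerC y x); ring.
Qed.

Lemma sqr_normB x y : `|x - y| ^+ 2 = `|x| ^+ 2 - 2 * inner x y + `|y| ^+ 2.
Proof. by rewrite sqr_normD normrN -scaleN1r innerZr; ring. Qed.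

(** A crude substitute for the Cauchy-Schwarz inequality: all that is needed
    is that the inner products of a bounded family with a fixed vector are
    bounded. *)
Lemma normr_inner_le x y : `|inner x y| <= `|x| ^+ 2 + `|y| ^+ 2.
Proof.
have := sqr_ge0 `|x + y|; have := sqr_ge0 `|x - y|.
have := sqr_ge0 `|x|; have := sqr_ge0 `|y|.
rewrite sqr_normB sqr_normD => *; rewrite ler_norml; apply/andP; split; lra.
Qed.

(** The Hilbert space identity behind every convergence proof for averaged
    operators: the last term measures the gain of strict convexity, and is
    what makes the weighted squared residuals of the iteration summable. *)
Lemma sqr_norm_convex t x y :
  `|(1 - t) *: x + t *: y| ^+ 2
  = (1 - t) * `|x| ^+ 2 + t * `|y| ^+ 2 - t * (1 - t) * `|x - y| ^+ 2.
Proof.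
rewrite sqr_normB sqr_normD innerZl innerZr !sqr_norm_inner.
by rewrite !(innerZl, innerZr); ring.
Qed.

(** Inner products against the basis are used as coordinates, because they are
    visibly bounded on bounded sets, whereas bounding the coordinates in the
    basis itself would require the equivalence of norms. *)
Definition inner_row x : 'rV[R]_(\dim {:X}) :=
  \row_i inner x (vbasis {:X})`_i.

Fact inner_row_linear : linear inner_row.
Proof. by move=> t x y; apply/rowP => i; rewrite !mxE innerDl innerZl. Qed.

HB.instance Definition _ :=
  GRing.isLinear.Build R X 'rV[R]_(\dim {:X}) *:%R inner_row inner_row_linear.

Lemma inner_row_inj : injective inner_row.
Proof.
apply: raddf_inj => x x0; apply/eqP; rewrite -normr_eq0 -sqrf_eq0.
apply/eqP; rewrite sqr_norm_inner [X in inner _ X](coord_vbasis (memvf x)).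
rewrite linear_sumr big1 // => i _; apply: (etrans (innerZr _ _ _)).
by move/rowP/(_ i): x0; rewrite !mxE => ->; rewrite mulr0.
Qed.

(** Linear maps out of a space of row vectors are Lipschitz, so closeness of
    the inner products with the basis controls closeness in [X]. *)
Lemma inner_row_left_inv :
  exists2 g : {linear 'rV[R]_(\dim {:X}) -> X}, cancel inner_row g &
    exists2 C : R, 0 <= C &
      forall (v : 'rV[R]_(\dim {:X})) (e : R), (forall i, `|v ord0 i| <= e) ->
      `|g v| <= e * C.
Proof.
pose f := linfun inner_row; pose g := (f^-1)%VF.
have fK : cancel f g.
  apply/lker0_lfunK/lker0P => x y; rewrite !lfunE; exact: inner_row_inj.
exists g => [x|]; first by rewrite -[RHS]fK lfunE.
exists (\sum_i `|g (delta_mx ord0 i)|) => [|v e ve]; first exact: sumr_ge0.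
rewrite [v in X in X <= _]row_sum_delta linear_sum mulr_sumr.
apply: (le_trans (ler_norm_sum _ _ _)); apply: ler_sum => i _.
by rewrite linearZ /= normrZ ler_wpM2r.
Qed.

(** Bolzano-Weierstrass in [X]: the inner products with the basis stay in a
    compact box, and the linear left inverse of [inner_row] carries a cluster
    point of the row vectors back to a cluster point of the sequence. *)
Lemma bounded_seq_has_cluster (u : nat -> X) (M : R) :
  (forall n, `|u n| <= M) ->
  exists y, forall (e : R) N, 0 < e -> exists2 n, (N <= n)%N & `|u n - y| < e.
Proof.
move=> uM; have [g gK [C C0 gC]] := inner_row_left_inv.
pose b i := `|(vbasis {:X})`_i| ^+ 2.
pose K (i : 'I_(\dim {:X})) := `[- (M ^+ 2 + b i), M ^+ 2 + b i]%classic.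
have inK : ((inner_row \o u) @ \oo)
    [set v : 'rV_(\dim {:X}) | forall i, K i (v ord0 i)].
  exists 0%N => // n _ i; rewrite /K /= mxE in_itv /= -ler_norml.
  apply: (le_trans (normr_inner_le _ _)); rewrite lerD2r.
  by rewrite ler_sqr ?nnegrE // (le_trans _ (uM n)).
have [w [_ wc]] := rV_compact (fun i => @segment_compact R _ _) _ inK.
exists (g w) => e N e0.
have d0 : 0 < e / (C + 1) by rewrite divr_gt0 // ltr_wpDl.
have tail : ((inner_row \o u) @ \oo)
    [set inner_row (u n) | n in [set n | (N <= n)%N]].
  by exists N => // n /= Nn; exists n.
(* The radius is e / (C + 1) rather than e / C because C may vanish. *)
have [_ [[n Nn <-] nw]] := wc _ _ tail (nbhsx_ballx w _ d0).
exists n => //; rewrite -[u n]gK -linearB /=.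
have /gC /le_lt_trans :
    forall i, `|(inner_row (u n) - w) ord0 i| <= e / (C + 1).
  by move=> i; have [_ /(_ ord0 i)] := nw; rewrite !mxE distrC => /ltW.
apply; rewrite -mulrA gtr_pMr // mulrC ltr_pdivrMr ?mul1r ?ltrDl //.
exact: ltr_wpDl.
Qed.

End InnerProduct.

(** * Sequences *)

Lemma infinitely_repeated_value {I : finType} (k : nat -> I) :
  exists i, forall N, exists2 n, (N <= n)%N & k n = i.
Proof.
apply: contrapT => /forallNP none.
have /choice[N kN] i : exists N, forall n, (N <= n)%N -> k n <> i.
  have /existsNP[N noN] := none i; exists N => n Nn kni.
  by apply: noN; exists n.
exact: (kN _ (\max_i N i)%N (leq_bigmax _) erefl).
Qed.

Lemma limn_inf_gt0 {R : realType} (u : nat -> R) : (forall n, 0 <= u n) ->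
  0 < limn_inf u -> exists2 c, 0 < c & \forall n \near \oo, c <= u n.
Proof.
move=> u0 linf.
(* A divergent [infs u] has the default limit 0, which is not positive. *)
have infs_cvg : cvgn (infs u).
  by apply: contrapT => /dvgP ninf; move: linf; rewrite /limn_inf ninf ltxx.
have [N _ Ninfs] := cvgr_gt _ infs_cvg _ linf.
exists (infs u N); first by apply: Ninfs => /=.
exists N => // n Nn; apply: ge_inf; last by exists n.
by exists 0 => _ [m _ <-].
Qed.

(** * The ball of attraction *)

(** An interior point of the ball can be pushed slightly further away from the
    centre without leaving the ball. At the centre itself there is no direction
    in which to push, hence the exclusion of [y = x]. *)
Lemma interior_cball_lt {R : realType} {X : normedModType R} (x y : X)
    (r : \bar R) : (cball x r)° y -> y != x -> (`|x - y|%:E < r)%E.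
Proof.
move=> /nbhs_ballP[e /= e0 ye] yx.
have nyx : 0 < `|y - x| by rewrite normr_gt0 subr_eq0.
pose t := e / 2 / `|y - x|.
have t0 : 0 < t by rewrite !divr_gt0.
have /ye : ball y e (y + t *: (y - x)).
  rewrite -ball_normE /= opprD addNKr normrN normrZ gtr0_norm //.
  by rewrite divfK ?gt_eqF //; lra.
apply: lt_le_trans; rewrite lte_fin distrC [ltRHS]distrC.
rewrite addrAC -[X in _ < `|X + _|]scale1r -scalerDl normrZ gtr0_norm.
  by rewrite mulrDl mul1r ltrDl mulr_gt0.
exact: addr_gt0.
Qed.

Lemma attraction_radius_gt {R : realType} {X : normedModType R} {I : finType}
    (phi : X -> set I) (x y : X) :
  (`|x - y|%:E < attraction_radius phi x)%E -> phi y `<=` phi x.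
Proof.
case/ereal_sup_gt => _ [d [_ sub] <-] xyd; apply: sub.
exact: ltW.
Qed.

(** The strict inequality of [interior_cball_lt] leaves room for all points [y]
    no further from [x] than [x0], unless [x0 = x]; in that case the only such
    point is [x] itself, where the inclusion is trivial. *)
Lemma attraction_ball {R : realType} {X : normedModType R} {I : finType}
    (phi : X -> set I) (x x0 : X) :
  (cball x (attraction_radius phi x))° x0 ->
  forall y, `|y - x| <= `|x0 - x| -> phi y `<=` phi x.
Proof.
move=> x0in y yx0; have [->//|yx] := eqVneq y x.
apply: attraction_radius_gt.
have /(interior_cball_lt x0in) : x0 != x.
  apply: contra_neq yx => x0x; apply/eqP; rewrite -subr_eq0 -normr_le0.
  by move: yx0; rewrite x0x subrr normr0.
by apply: le_lt_trans; rewrite lee_fin distrC [leRHS]distrC.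
Qed.

(** * Krasnoselskii-Mann iterations with varying operators *)

Lemma mann_step {R : realType} {X : finHilbertType R} (f : X -> X) (t : R)
    (x p : X) : nonexpansive f -> f p = p -> 0 <= t ->
  `|(1 - t) *: x + t *: f x - p| ^+ 2 + t * (1 - t) * `|x - f x| ^+ 2
  <= `|x - p| ^+ 2.
Proof.
move=> fne fp t0.
have -> : (1 - t) *: x + t *: f x - p = (1 - t) *: (x - p) + t *: (f x - p).
  by rewrite !scalerBr addrACA -opprD -scalerDl subrK scale1r.
have := sqr_norm_convex t (x - p) (f x - p).
rewrite opprB addrA subrK => ->; rewrite subrK.
have : `|f x - p| ^+ 2 <= `|x - p| ^+ 2.
  by rewrite -{1}fp ler_sqr ?nnegrE //; exact: fne.
by move=> /(ler_wpM2l t0); lra.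
Qed.

Section MannIteration.
Context {R : realType} {X : finHilbertType R} {I : finType}.
Variables (T_ : I -> X -> X) (k : nat -> I) (lambda : nat -> R).
Variable x_ : nat -> X.
Hypothesis T_nonexpansive : forall i, nonexpansive (T_ i).
Hypothesis lambda01 : forall n, 0 < lambda n <= 1.
Hypothesis x_step : forall n,
  x_ n.+1 = (1 - lambda n) *: x_ n + lambda n *: T_ (k n) (x_ n).

Let weight n := lambda n * (1 - lambda n).
Let residual n := `|x_ n - T_ (k n) (x_ n)|.

Let weight_ge0 n : 0 <= weight n.
Proof.
by have /andP[l0 l1] := lambda01 n; rewrite mulr_ge0 ?subr_ge0 // ltW. Qed.

Lemma mann_decrease n p : T_ (k n) p = p ->
  `|x_ n.+1 - p| ^+ 2 + weight n * residual n ^+ 2 <= `|x_ n - p| ^+ 2.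
Proof.
by move=> fp; rewrite x_step mann_step //; have /andP[/ltW] := lambda01 n.
Qed.

Lemma mann_fejer n p : T_ (k n) p = p -> `|x_ n.+1 - p| <= `|x_ n - p|.
Proof.
move=> fp; rewrite -ler_sqr ?nnegrE //; apply: le_trans (mann_decrease fp).
by rewrite lerDl mulr_ge0 ?sqr_ge0.
Qed.

(** The squared distances to [p] decrease, so their consecutive differences tend
    to 0; these differences dominate the squared residuals up to the weights,
    which are eventually bounded away from 0. *)
Lemma mann_residual_cvg0 p (e : R) : (forall n, T_ (k n) p = p) ->
  0 < limn_inf weight -> 0 < e -> \forall n \near \oo, residual n < e.
Proof.
move=> fp /(limn_inf_gt0 weight_ge0)[c c0 cw] e0.
pose d n := `|x_ n - p| ^+ 2.
have d_cvg : cvgn d.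
  apply: nonincreasing_is_cvgn; last by exists 0 => _ [n _ <-]; exact: sqr_ge0.
  by apply/nonincreasing_seqP => n; rewrite ler_sqr ?nnegrE // mann_fejer.
have diff0 : d n - d n.+1 @[n --> \oo] --> (0 : R).
  rewrite -(subrr (limn d)); apply: cvgB => //.
  by rewrite (cvg_shiftS d).
have ce0 : 0 < c * e ^+ 2 by rewrite mulr_gt0 ?exprn_gt0.
apply: filterS2 (cw) (cvgr_lt _ diff0 _ ce0) => n cwn dn.
rewrite -ltr_sqr ?nnegrE ?normr_ge0 //; last exact: ltW.
rewrite -(ltr_pM2l c0); apply: le_lt_trans dn.
rewrite lerBrDl; apply: le_trans (mann_decrease (fp n)).
by rewrite lerD2l ler_wpM2r ?sqr_ge0.
Qed.

(** An operator that moves [y] has a residual bounded away from 0 near [y]; as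
    there are finitely many operators, the bound can be made uniform. *)
Lemma small_residual_fixed (y : X) : exists2 e : R, 0 < e &
  forall n, residual n < e -> `|x_ n - y| < e -> T_ (k n) y = y.
Proof.
(* If |x_n - y| and the residual are both < e, nonexpansiveness gives
   |y - T_i y| < 3 e. *)
pose e := \big[Num.min/1]_(i | T_ i y != y) (`|y - T_ i y| / 3).
exists e => [|n rn xny].
  apply/bigmin_gtP; split=> // i yi.
  by rewrite divr_gt0 // normr_gt0 subr_eq0 eq_sym.
apply/eqP; apply: contraT => yi.
have : e <= `|y - T_ (k n) y| / 3 by exact: bigmin_le_cond.
have := T_nonexpansive (k n) (x_ n) y.
have := ler_distD (x_ n) y (T_ (k n) y).
have := ler_distD (T_ (k n) (x_ n)) (x_ n) (T_ (k n) y).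
rewrite (distrC y (x_ n)); move: rn; rewrite /residual => *; lra.
Qed.

(** A cluster point traps the iteration: once a late iterate is close to [y],
    small residuals force the operator in use to fix [y], hence the next
    iterate is no further from [y], and the situation repeats itself. *)
Lemma mann_cluster_cvg (y : X) :
  (forall e, 0 < e -> \forall n \near \oo, residual n < e) ->
  (forall (e : R) N, 0 < e -> exists2 n, (N <= n)%N & `|x_ n - y| < e) ->
  x_ @ \oo --> y /\ \forall n \near \oo, T_ (k n) y = y.
Proof.
move=> res0 yc; have [e e0 fixed] := small_residual_fixed y.
have [N _ resN] := res0 _ e0.
have trapped (e' : R) : 0 < e' -> e' <= e ->
    \forall n \near \oo, `|x_ n - y| < e'.
  move=> e'0 e'e; have [n0 Nn0 xn0] := yc e' N e'0.
  exists n0 => // n /= /subnKC <-; elim: (n - n0)%N => [|m IH].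
    by rewrite addn0.
  rewrite addnS; apply: le_lt_trans (IH); apply: mann_fejer.
  apply: fixed; last exact: (lt_le_trans IH e'e).
  by apply: resN => /=; rewrite (leq_trans Nn0) ?leq_addr.
split.
  apply/cvgrPdist_lt => d d0; near=> n; rewrite distrC.
  have : `|x_ n - y| < Num.min d e.
    by near: n; apply: trapped; rewrite ?lt_min ?d0 ?ge_min ?lexx ?orbT.
  by rewrite lt_min => /andP[].
near=> n; apply: fixed; near: n; [exact: res0|exact: trapped].
Unshelve. all: by end_near. Qed.

End MannIteration.

(** * Convergence *)

Theorem theorem4p2 (R : realType) (X : finHilbertType R) (I : finType)
    (T : X -> set X) (T_ : I -> X -> X) (phi : X -> set I)
    (hT : union_nonexpansive T T_ phi)
    (xstar : X) (hxstar : strongFix T xstar)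
    (lambda : nat -> R) (hlambda : forall n, 0 < lambda n <= 1)
    (hliminf : 0 < limn_inf (fun n => lambda n * (1 - lambda n)))
    (x_ : nat -> X)
    (hx0 : (cball xstar (attraction_radius phi xstar))° (x_ 0%N))
    (hx : forall n, [set (1 - lambda n) *: x_ n + lambda n *: y | y in T (x_ n)]
                      (x_ n.+1)) :
  exists2 xbar : X,
    (Fix T `&` cball xstar (attraction_radius phi xstar)) xbar &
    x_ @ \oo --> xbar.
Proof.
have [TE Tne osc _] := hT.
have /choice[k kP] n : exists i, phi (x_ n) i /\
    x_ n.+1 = (1 - lambda n) *: x_ n + lambda n *: T_ i (x_ n).
  by have [y] := hx n; rewrite TE => -[i ? <-] <-; exists i.
have phik n : phi (x_ n) (k n) by case: (kP n).
have x_step n := (kP n).2.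
have fix_star i : phi xstar i -> T_ i xstar = xstar.
  move=> xi; have : T xstar (T_ i xstar) by rewrite TE; exists i.
  by rewrite hxstar.
(* By induction the iterate is in the region where the active indices are active
   at xstar, so the operator in use fixes xstar and the distance decreases. *)
have x_near n : `|x_ n - xstar| <= `|x_ 0%N - xstar|.
  elim: n => // n IH; apply: le_trans (IH).
  apply: (mann_fejer Tne hlambda x_step).
  exact/fix_star/(attraction_ball hx0 IH).
have fixk n : T_ (k n) xstar = xstar.
  exact/fix_star/(attraction_ball hx0 (x_near n)).
have [y yc] : exists y, forall (e : R) N, 0 < e ->
    exists2 n, (N <= n)%N & `|x_ n - y| < e.
  apply: (@bounded_seq_has_cluster _ _ _ (`|x_ 0%N - xstar| + `|xstar|)) => n.
  rewrite -[x_ n in leLHS](subrK xstar).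
  by apply: le_trans (ler_normD _ _) _; rewrite lerD2r.
have res0 e := mann_residual_cvg0 (e := e) Tne hlambda x_step fixk hliminf.
have [xy [N _ Nfix]] := mann_cluster_cvg Tne hlambda x_step res0 yc.
exists y => //; split.
  (* Outer semicontinuity along a subsequence on which the index is constant. *)
  have [i i_inf] := infinitely_repeated_value k.
  have /choice[s sP] n : exists m, (n <= m)%N /\ k m = i.
    by have [m] := i_inf n; exists m.
  rewrite /Fix /= TE; exists i.
    apply: (osc (x_ \o s) (fun=> i)); [|exact: cvg_cst|].
      apply: cvg_comp xy; apply/cvgnyPge => m; exists m => // n /= mn.
      exact: leq_trans mn (sP n).1.
    by move=> n /=; rewrite -(sP n).2.
  by rewrite -(sP N).2; apply: Nfix; exact: (sP N).1.
have : cball xstar (attraction_radius phi xstar) (x_ 0%N).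
  exact: interior_subset hx0.
rewrite /cball /=; apply: le_trans; rewrite lee_fin distrC [leRHS]distrC.
apply/ler_addgt0Pr => e e0; have [n _ xne] := yc e 0%N e0.
rewrite [leRHS]addrC; apply: le_trans (ler_distD (x_ n) _ _) _.
by rewrite lerD ?x_near // distrC ltW.
Qed.
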